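(* Let $A$ be an $n\times n$ dilation matrix and let $D$ be a digit set for $A$. Then $A$ yields a radix representation with digit set $D$ if and only if the set $T(A,D)$ tiles $\mathbb{R}^n$ under translation by $\mathbb{Z}^n$ and the origin $\mathbf{0}$ is in the interior of $T(A,D)$.
   Context: A dilation matrix (for $\mathbb{Z}^n$) is an $n\times n$ matrix $A$ with integer entries, all of whose eigenvalues $\lambda$ satisfy $|\lambda|>1$. A digit set for $A$ is a complete set $D\subset\mathbb{Z}^n$ of coset representatives of $\mathbb{Z}^n/A(\mathbb{Z}^n)$ (exactly one element from each coset) with $\mathbf{0}\in D$. $A$ yields a radix representation with digit set $D$ if for every $x\in\mathbb{Z}^n$ there exist a nonnegative integer $N=N(x)$ and digits $d_0,d_1,\ldots,d_N\in D$ such that $x=\sum_{j=0}^{N}A^jd_j$. $T(A,D):=\{\xi\in\mathbb{R}^n:\ \xi=\sum_{j=1}^{\infty}A^{-j}d_j,\ d_j\in D \text{ for all } j\ge 1\}$. A measurable set $Q\subset\mathbb{R}^n$ tiles $\mathbb{R}^n$ under translation by $\mathbb{Z}^n$ if $\bigcup_{k\in\mathbb{Z}^n}(Q+k)=\mathbb{R}^n$ and $(Q+k_1)\cap(Q+k_2)$ has Lebesgue measure zero for any two distinct $k_1,k_2\in\mathbb{Z}^n$. *)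

(* Defs.v *)
From mathcomp Require Import all_boot all_order all_algebra.
From mathcomp Require Import complex.
From mathcomp Require Import all_classical all_reals all_analysis.

Set Implicit Arguments.
Unset Strict Implicit.
Unset Printing Implicit Defensive.

Import Order.TTheory GRing.Theory Num.Theory.
Import numFieldNormedType.Exports.

Local Open Scope classical_set_scope.
Local Open Scope ring_scope.

Definition dilation_matrix (R : realType) (n : nat) (A : 'M[int]_n) : Prop :=
  forall l : R[i], eigenvalue (map_mx intr A : 'M[R[i]]_n) l -> 1 < `|l|.

Definition digit_set (n : nat) (A : 'M[int]_n) (D : set 'cV[int]_n) : Prop :=
  D 0 /\
  forall x : 'cV[int]_n,
    exists! d : 'cV[int]_n, D d /\ exists y : 'cV[int]_n, x = d + A *m y.

Definition yields_radix_representation (n : nat) (A : 'M[int]_n)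
    (D : set 'cV[int]_n) : Prop :=
  forall x : 'cV[int]_n,
    exists (N : nat) (d : 'I_N.+1 -> 'cV[int]_n),
      (forall j, D (d j)) /\ x = \sum_(j < N.+1) A ^+ j *m d j.

(* [invmx] is the genuine inverse here: a dilation matrix is nonsingular, as 0
   is not an eigenvalue. *)
Definition digit_tile (R : realType) (n : nat) (A : 'M[int]_n)
    (D : set 'cV[int]_n) : set 'cV[R]_n :=
  [set xi | exists d : nat -> 'cV[int]_n,
      (forall j, (1 <= j)%N -> D (d j)) /\
      (fun N => \sum_(1 <= j < N.+1)
          invmx (map_mx intr A : 'M[R]_n) ^+ j *m map_mx intr (d j))
        @ \oo --> xi].
Arguments digit_tile R {n} A D _.

Definition box (R : realType) (n : nat) (a b : 'cV[R]_n) : set 'cV[R]_n :=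
  [set x | forall i, a i 0 <= x i 0 <= b i 0].

Definition box_volume (R : realType) (n : nat) (a b : 'cV[R]_n) : R :=
  \prod_(i < n) (b i 0 - a i 0).

(* Lebesgue outer measure on R^n, meaningful for n > 0 only: in dimension 0
   every box has volume 1, so that even the empty set gets value +oo. *)
Definition lebesgue_outer (R : realType) (n : nat) (E : set 'cV[R]_n) : \bar R :=
  ereal_inf [set (\sum_(0 <= k <oo) (box_volume (c k).1 (c k).2)%:E)%E
            | c in [set c : nat -> 'cV[R]_n * 'cV[R]_n |
                (forall k i, (c k).1 i 0 <= (c k).2 i 0) /\
                E `<=` \bigcup_k box (c k).1 (c k).2]].

Definition translate (R : realType) (n : nat) (Q : set 'cV[R]_n)
    (k : 'cV[int]_n) : set 'cV[R]_n :=
  [set x + map_mx intr k | x in Q].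

(* Lebesgue measurability is Caratheodory measurability for the Lebesgue outer
   measure, and Lebesgue measure is the restriction of that outer measure. *)
Definition tiles_by_integer_translation (R : realType) (n : nat)
    (Q : set 'cV[R]_n) : Prop :=
  [/\ (@lebesgue_outer R n).-caratheodory Q,
      \bigcup_(k in [set: 'cV[int]_n]) translate Q k = [set: 'cV[R]_n] &
      forall k1 k2 : 'cV[int]_n, k1 <> k2 ->
        lebesgue_outer (translate Q k1 `&` translate Q k2) = 0%E].

(* Main.v *)
Require Import Defs.
From HB Require Import structures.
From mathcomp Require Import all_boot all_order all_algebra.
From mathcomp Require Import complex.
From mathcomp Require Import all_classical all_reals all_analysis.
From mathcomp Require Import measurable_realfun.
From mathcomp Require Import zify ring lra.

(** Write B for the inverse of A, T for the tile and phi for the quotient map of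
    the integer lattice, defined by x = d + A phi(x) with d a digit.  Iterating
    phi produces the digits of x from the lowest one upwards, so A yields a
    radix representation exactly when every phi-orbit reaches 0
    ([radix_iff_nilpotent]).

    Everything about T follows from one description of it: since the powers of B
    decay geometrically, T is the largest bounded set X in which every x has a
    digit d with A x - d again in X ([tile_maximal]).  Hence T is closed, is
    stable under x |-> B (x + d), and the union of its integer translates is a
    closed set which contains the lattice and is mapped into itself by B; that
    union is therefore everything ([shifted_cover]).

    Suppose that every phi-orbit reaches 0.  If T + k contains 0, then -k lies
    in T, and expanding -k inside T gives arbitrarily long backward phi-orbits
    of k made of lattice points in a fixed ball; phi kills all those points
    after a common number of steps, so k = 0 ([radix_isolates_origin]).  The
    other translates are closed and locally finite, so they avoid a
    neighbourhood of 0, which T must cover.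
    Moreover the set V of points in at least two translates is closed, periodic,
    mapped into itself by A, and misses 0.  Its complement U is open, contains
    every B^m U, and finitely many translates of it cover the space; those of
    B^m U, by vectors that tend to 0 with m, cover it as well.  So U fills a
    fixed proportion of every box, and a set that misses a fixed proportion of
    every box is null ([null_of_invariant]).

    Conversely, phi-orbits are bounded, hence reach a periodic point w.  The
    negatives of the points of a phi-cycle form a set X as above, so -w is in T
    and 0 is in T + w.  If w were not 0, the copy of B^m T through -w would show
    that T + w contains a small box inside the neighbourhood of 0 covered by T,
    whereas distinct translates meet in a null set and boxes have positive
    measure ([tiling_nilpotent]). *)

Set Implicit Arguments.
Unset Strict Implicit.
Unset Printing Implicit Defensive.

Import Order.TTheory GRing.Theory Num.Theory.
Import numFieldNormedType.Exports.

Local Open Scope classical_set_scope.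
Local Open Scope ring_scope.

(** * Lebesgue outer measure and boxes *)

Section BoxCovers.
Variable R : realType.

(** Slicing gives the induction on the dimension: for fixed last coordinate y,
    the boxes whose last side contains y cover the slice, and integrating that
    inequality over y multiplies each volume by the length of a side.  The
    predicate P is there because a slice meets only some of the boxes.  Points
    are sequences of which the first m terms count, so that all dimensions
    share one type. *)
Lemma cover_volume_ge (m : nat) (P : pred nat) (a b : nat -> R)
    (ak bk : nat -> nat -> R) :
    (forall i, a i <= b i) ->
    (forall k i, ak k i <= bk k i) ->
    (forall x : nat -> R, (forall i, (i < m)%N -> a i <= x i <= b i) ->
       exists k, P k /\ forall i, (i < m)%N -> ak k i <= x i <= bk k i) ->
  ((\prod_(i < m) (b i - a i))%:E <=
   \sum_(0 <= k <oo) ((P k)%:R * \prod_(i < m) (bk k i - ak k i))%:E)%E.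
Proof.
elim: m P => [|m IH] P ab abk cov.
  have [k [Pk _]] := cov a (fun i => ltac:(by [])).
  apply: le_trans (nneseries_lim_ge k.+1 _) => /=; last first.
    by move=> i _ _; rewrite big_ord0 mulr1 lee_fin.
  rewrite big_nat_recr//= !big_ord0 Pk mulr1.
  by apply: leeDr; apply: sume_ge0 => i _; rewrite big_ord0 mulr1 lee_fin.
pose I k : set R := [set` `[ak k m, bk k m]].
pose c k := (P k)%:R * \prod_(i < m) (bk k i - ak k i).
have c0 k : 0 <= c k.
  by rewrite mulr_ge0// prodr_ge0// => i _; rewrite subr_ge0.
have mI k : measurable (I k) by exact: measurable_itv.
have mJ : measurable ([set` `[a m, b m]] : set R) by exact: measurable_itv.
have lenJ (u v : R) : u <= v ->
    @lebesgue_measure R [set` `[u, v]] = (v - u)%:E.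
  rewrite le_eqVlt lebesgue_measure_itv/= lte_fin => /predU1P[->|->].
    by rewrite ltxx subrr.
  by rewrite EFinB.
(* The inequality for the slice at height y, before integration. *)
have slice y : [set` `[a m, b m]] y ->
    ((\prod_(i < m) (b i - a i))%:E <=
     \sum_(0 <= k <oo) ((c k)%:E * (\1_(I k) y)%:E))%E.
  move=> /=; rewrite in_itv/= => yab.
  apply: le_trans (IH (fun k => P k && (y \in I k)) ab abk _) _.
    move=> x xab.
    have [|k [Pk xk]] := cov (fun i => if i == m then y else x i).
      move=> i; rewrite ltnS leq_eqVlt => /predU1P[->|im]; first by rewrite eqxx.
      by rewrite ltn_eqF// xab.
    exists k; split.
      rewrite Pk/= inE /I/= in_itv/=.
      by have := xk m (ltnSn m); rewrite eqxx.
    by move=> i im; have := xk i (leqW im); rewrite ltn_eqF.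
  apply: lee_nneseries => [k _ _|k _].
    by rewrite lee_fin mulr_ge0// prodr_ge0// => i _; rewrite subr_ge0.
  rewrite -EFinM lee_fin /c indicE.
  by case: (P k); case: (y \in I k); rewrite /= ?(mul0r,mulr0,mul1r,mulr1).
rewrite big_ord_recr/= EFinM -(lenJ _ _ (ab m)).
rewrite -(integral_cst (@lebesgue_measure R) mJ (\prod_(i < m) (b i - a i))%:E).
apply: (@le_trans _ _ (\int[lebesgue_measure]_(y in [set` `[a m, b m]])
    (\sum_(0 <= k <oo) ((c k)%:E * (\1_(I k) y)%:E)))%E).
  apply: ge0_le_integral => //=.
  - by move=> x _; rewrite lee_fin prodr_ge0// => i _; rewrite subr_ge0.
  - apply: ge0_emeasurable_sum => k.
      by move=> x _ _; rewrite -EFinM lee_fin mulr_ge0.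
    move=> _; apply: measurable_funeM; apply/measurable_EFinP.
    exact: (measurable_indic (mI _)).
rewrite integral_nneseries//.
- apply: lee_nneseries => [k _ _|k _].
    by apply: integral_ge0 => x _; rewrite -EFinM lee_fin mulr_ge0.
  rewrite ge0_integralZl ?lee_fin//; last first.
    by apply/measurable_EFinP; exact: (measurable_indic (mI _)).
  rewrite integral_indic; [|exact: mJ|exact: mI].
  rewrite big_ord_recr/= mulrA -/(c k) [leRHS]EFinM.
  rewrite lee_wpmul2l ?lee_fin//= -lenJ//.
  by apply: le_measure; rewrite ?inE//; exact: (measurableI _ _ (mI k) mJ).
- move=> k; apply: measurable_funeM; apply/measurable_EFinP.
  exact: (measurable_indic (mI _)).
- by move=> k x _; rewrite -EFinM lee_fin mulr_ge0.
Qed.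

Section LebesgueOuter.
Variable n : nat.
Implicit Types (a b : 'cV[R]_n.+1) (E X : set 'cV[R]_n.+1)
  (c : nat -> 'cV[R]_n.+1 * 'cV[R]_n.+1).

Definition box_cover E c :=
  (forall k i, (c k).1 i 0 <= (c k).2 i 0) /\
  E `<=` \bigcup_k box (c k).1 (c k).2.

Definition cover_sum c : \bar R :=
  (\sum_(0 <= k <oo) (box_volume (c k).1 (c k).2)%:E)%E.

Local Notation mu := (@lebesgue_outer R n.+1).

Lemma box_volume_ge0 a b : (forall i, a i 0 <= b i 0) -> 0 <= box_volume a b.
Proof. by move=> ab; apply: prodr_ge0 => i _; rewrite subr_ge0. Qed.

Lemma box_volumexx a : box_volume a a = 0.
Proof. by rewrite /box_volume big_ord_recl subrr mul0r. Qed.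

Lemma lebesgue_outer_le_cover E c : box_cover E c -> (mu E <= cover_sum c)%E.
Proof. by move=> Ec; apply: ereal_inf_lbound; exists c. Qed.

Lemma cover_sum_ge0 E c : box_cover E c -> (0 <= cover_sum c)%E.
Proof.
by move=> [c0 _]; apply: nneseries_ge0 => k _ _; rewrite lee_fin box_volume_ge0.
Qed.

Lemma lebesgue_outer_ge0 E : (0 <= mu E)%E.
Proof. by apply: le_ereal_inf_tmp => _ [c Ec <-]; exact: cover_sum_ge0 Ec. Qed.

Lemma lebesgue_outer_cover E (e : R) : (mu E < +oo)%E -> 0 < e ->
  exists2 c, box_cover E c & (cover_sum c <= mu E + e%:E)%E.
Proof.
move=> Eoo e0.
have /(lb_ereal_inf_adherent e0)[_ [c Ec <-] ce] : mu E \is a fin_num.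
  by rewrite ge0_fin_numE ?lebesgue_outer_ge0.
by exists c => //; exact: ltW.
Qed.

Lemma le_lebesgue_outer : {homo mu : E X / E `<=` X >-> (E <= X)%E}.
Proof.
move=> E X EX; apply: le_ereal_inf => _ [c [c0 cX] <-]; exists c => //.
by split=> // x /EX /cX.
Qed.

Lemma lebesgue_outer0 : mu set0 = 0%E.
Proof.
apply/eqP; rewrite eq_le lebesgue_outer_ge0 andbT.
have cov0 : box_cover set0 (fun=> (0, 0)) by split.
apply: le_trans (lebesgue_outer_le_cover cov0) _.
by rewrite /cover_sum eseries0// => k _ _; rewrite /= box_volumexx.
Qed.

(** Covers of the k-th set within e / 2^(k+1) of its measure are merged into one
    sequence of boxes along a bijection between nat and nat * nat. *)
Lemma lebesgue_outer_sigma_subadditive : sigma_subadditive mu.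
Proof.
move=> E; have [[i ioo]|/forallNP Efin] := pselect (exists i, mu (E i) = +oo%E).
  rewrite (eseries_pinfty _ _ ioo) ?leey// => k _.
  by rewrite -ltNye (lt_le_trans _ (lebesgue_outer_ge0 _)).
apply/lee_addgt0Pr => e e0.
rewrite (le_trans _ (epsilon_trick _ _ (ltW e0)))//; last first.
  by move=> k; exact: lebesgue_outer_ge0.
have /choice[G PG] : forall k, exists c, box_cover (E k) c /\
    (cover_sum c <= mu (E k) + (e / (2 ^ k.+1)%:R)%:E)%E.
  move=> k; have [||c] := @lebesgue_outer_cover (E k) (e / (2 ^ k.+1)%:R).
  - by rewrite ltey; apply/eqP/Efin.
  - by rewrite divr_gt0// ltr0n expn_gt0.
  - by exists c.
pose vol (ij : nat * nat) := (box_volume (G ij.1 ij.2).1 (G ij.1 ij.2).2)%:E.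
have vol0 ij : (0 <= vol ij)%E.
  by rewrite lee_fin box_volume_ge0//; exact: (PG ij.1).1.1.
have /card_esym/ppcard_eqP[f] := card_nat2.
apply: (@le_trans _ _ (cover_sum (fun k => G (f k).1 (f k).2))).
  apply: lebesgue_outer_le_cover; split => [k i|x [k _ /((PG k).1.2)[j _ xj]]].
    exact: (PG _).1.1.
  by exists (f^-1%FUN (k, j)) => //; rewrite invK ?inE.
rewrite /cover_sum nneseries_esumT; last by move=> k; exact: (vol0 (f k)).
rewrite -(@reindex_esum _ _ _ setT setT f vol); last exact: 'bij_f.
rewrite -[X in esum X _](_ : [set: nat] `*`` (fun=> [set: nat]) = setT); last first.
  by apply/seteqP; split=> // -[].
rewrite -(@esum_esum _ _ _ _ _ (fun i j => vol (i, j)))//=.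
rewrite nneseries_esumT; last first.
  by move=> k; rewrite adde_ge0 ?lebesgue_outer_ge0// lee_fin divr_ge0// ltW.
apply: le_esum => i _; rewrite -nneseries_esumT; last by move=> j; exact: vol0.
exact: (PG i).2.
Qed.

HB.instance Definition _ := isOuterMeasure.Build R _ mu
  lebesgue_outer0 lebesgue_outer_ge0 le_lebesgue_outer
  lebesgue_outer_sigma_subadditive.

Lemma lebesgue_outer_shift E (t : 'cV[R]_n.+1) :
  (mu [set (x + t)%R | x in E] <= mu E)%E.
Proof.
apply: le_ereal_inf_tmp => _ [c [c0 cE] <-].
have -> : (\sum_(0 <= k <oo) (box_volume (c k).1 (c k).2)%:E)%E =
    cover_sum (fun k => ((c k).1 + t, (c k).2 + t)).
  apply: eq_eseriesr => k _; congr (_%:E); apply: eq_bigr => i _ /=.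
  by rewrite !mxE opprD addrACA subrr addr0.
apply: lebesgue_outer_le_cover; split=> [k i|_ [x /cE[k _ xk] <-]] /=.
  by rewrite !mxE lerD2r.
by exists k => // i /=; rewrite !mxE !lerD2r.
Qed.

(** The lower bound says that the volume of a box does not exceed the sum of the
    volumes of boxes covering it, which is [cover_volume_ge]. *)
Lemma lebesgue_outer_box a b : (forall i, a i 0 <= b i 0) ->
  mu (box a b) = (box_volume a b)%:E.
Proof.
move=> ab; apply/eqP; rewrite eq_le; apply/andP; split.
  (* One box, followed by boxes of volume 0. *)
  pose c k := if k is 0 then (a, b) else (a, a).
  have cab : box_cover (box a b) c by split=> [[|k] i//|x xab]; exists 0.
  apply: le_trans (lebesgue_outer_le_cover cab) _.
  rewrite /cover_sum (nneseries_split _ 1)//=; last first.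
    by move=> [|k] _//=; rewrite lee_fin ?box_volumexx ?box_volume_ge0.
  rewrite big_nat1 /= eseries0 ?adde0// => -[|k]//= _ _.
  by rewrite box_volumexx.
apply: le_ereal_inf_tmp => _ [c [c0 cE] <-].
pose ext (v : 'cV[R]_n.+1) (i : nat) := v (inord i) 0.
have volE (u v : 'cV[R]_n.+1) :
    box_volume u v = \prod_(i < n.+1) (ext v i - ext u i).
  by apply: eq_bigr => i _; rewrite /ext inord_val.
rewrite volE; apply: le_trans (@cover_volume_ge n.+1 xpredT (ext a) (ext b)
    (fun k => ext (c k).1) (fun k => ext (c k).2) _ _ _) _ => //.
- by move=> i; exact: ab.
- by move=> k i; exact: c0.
- move=> x xab; have [|k _ xk] := cE (\col_i x i).
    by move=> i; rewrite mxE; have := xab i (ltn_ord i); rewrite /ext inord_val.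
  exists k; split=> // i im; have := xk (inord i).
  by rewrite mxE inordK.
- apply: lee_nneseries => [k _ _|k _]; last by rewrite mul1r volE.
  by rewrite mul1r -volE lee_fin box_volume_ge0.
Qed.

(** The hyperplane cuts every box of a cover into two boxes whose volumes add up
    to the volume of that box. *)
Lemma caratheodory_halfspace (i : 'I_n.+1) (r : R) :
  mu.-caratheodory [set x | x i 0 <= r].
Proof.
apply: le_caratheodory_measurable => X.
apply: le_ereal_inf_tmp => _ [c [c0 cX] <-].
pose set_coord (v : 'cV[R]_n.+1) s : 'cV[R]_n.+1 :=
  \col_j (if j == i then s else v j 0).
(* The height r, clamped to the i-th side of the k-th box. *)
pose s k := Num.max ((c k).1 i 0) (Num.min ((c k).2 i 0) r).
have s1 k : (c k).1 i 0 <= s k by rewrite le_max lexx.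
have s2 k : s k <= (c k).2 i 0 by rewrite ge_max c0 ge_min lexx.
pose c1 k := ((c k).1, set_coord (c k).2 (s k)).
pose c2 k := (set_coord (c k).1 (s k), (c k).2).
have cov1 : box_cover (X `&` [set x | x i 0 <= r]) c1.
  split=> [k j|x [/cX[k _ xk] /= xr]]; first by rewrite /= mxE; case: eqP => [->|].
  exists k => // j /=; rewrite mxE; case: eqP => [->|_]; last exact: xk.
  by have /andP[-> xb] := xk i; rewrite le_max le_min xb xr orbT.
have cov2 : box_cover (X `&` ~` [set x | x i 0 <= r]) c2.
  split=> [k j|x [/cX[k _ xk] /= /negP]]; first by rewrite /= mxE; case: eqP => [->|].
  rewrite -ltNge => rx; exists k => // j /=; rewrite mxE.
  case: eqP => [->|_]; last exact: xk.
  by have /andP[ax ->] := xk i; rewrite ge_max ax ge_min (ltW rx) orbT.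
apply: le_trans (leeD (lebesgue_outer_le_cover cov1)
  (lebesgue_outer_le_cover cov2)) _.
rewrite /cover_sum -nneseriesD.
- apply: lee_nneseries => [k _ _|k _].
    by rewrite adde_ge0// lee_fin box_volume_ge0//; [exact: cov1.1|exact: cov2.1].
  rewrite -EFinD lee_fin /box_volume (bigD1 i)//= [X in _ + X](bigD1 i)//=.
  rewrite [leRHS](bigD1 i)//= !mxE eqxx.
  rewrite (eq_bigr (fun j => (c k).2 j 0 - (c k).1 j 0)); last first.
    by move=> j /negbTE ji; rewrite mxE ji.
  rewrite [X in _ + _ * X](eq_bigr (fun j => (c k).2 j 0 - (c k).1 j 0)); last first.
    by move=> j /negbTE ji; rewrite mxE ji.
  by rewrite -mulrDl addrC subrKA.
- by move=> k _; rewrite lee_fin box_volume_ge0//; exact: cov1.1.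
- by move=> k _; rewrite lee_fin box_volume_ge0//; exact: cov2.1.
Qed.

End LebesgueOuter.
End BoxCovers.

(** * Sup norm and locally finite unions *)

Section NormFacts.
Variables (R : realType) (n : nat).
Implicit Types (x y : 'cV[R]_n) (F : set 'cV[R]_n).

Lemma coord_le_norm x i : `|x i 0| <= `|x|.
Proof.
rewrite [leRHS]/Num.Def.normr/= mx_normrE.
by apply/bigmax_geP; right => /=; exists (i, 0).
Qed.

Lemma norm_le_coord x (e : R) : 0 <= e -> (forall i, `|x i 0| <= e) -> `|x| <= e.
Proof.
move=> e0 xe; rewrite [leLHS]/Num.Def.normr/= mx_normrE.
by rewrite (bigmax_le _ e0)//= => -[i j] _ /=; rewrite ord1.
Qed.

Lemma norm_lt_coord x (e : R) : 0 < e -> (forall i, `|x i 0| < e) -> `|x| < e.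
Proof.
move=> e0 xe; rewrite [ltLHS]/Num.Def.normr/= mx_normrE.
by apply/bigmax_ltP; split=> // -[i j] _ /=; rewrite ord1.
Qed.

Lemma open_normP F x : open F -> F x ->
  exists2 e : R, 0 < e & forall y, `|x - y| < e -> F y.
Proof.
move=> oF Fx; have /nbhs_ballP[e /= e0 eF] : nbhs x F by exact: open_nbhs_nbhs.
by exists e => // y xy; apply: eF; rewrite -ball_normE.
Qed.

Lemma closed_normP F :
  (forall x, (forall e : R, 0 < e -> exists2 y, F y & `|x - y| < e) -> F x) ->
  closed F.
Proof.
move=> h x clx; apply: h => e e0.
have [y [Fy]] := clx _ (nbhsx_ballx x _ e0).
by rewrite -ball_normE/=; exists y.
Qed.

Lemma closure_normP F x (e : R) : closure F x -> 0 < e ->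
  exists2 y, F y & `|x - y| < e.
Proof.
move=> clx e0; have [y [Fy]] := clx _ (nbhsx_ballx x _ e0).
by rewrite -ball_normE/=; exists y.
Qed.

(** Near a given point the union reduces to a finite one. *)
Lemma closed_locally_finite (I : choiceType) (G : I -> set 'cV[R]_n) :
    (forall i, closed (G i)) ->
    (forall x, exists2 e : R, 0 < e & finite_set
       [set i | exists2 y, G i y & `|x - y| < e]) ->
  closed (\bigcup_i G i).
Proof.
move=> clG locfin x clx; have [e e0 fin] := locfin x.
have clJ := closed_bigcup fin (fun i _ => clG i).
have [i _ Gx] : (\bigcup_(i in [set i | exists2 y, G i y & `|x - y| < e]) G i) x.
  apply: clJ => B /nbhs_ballP[d /= d0 dB].
  have de0 : 0 < Num.min d e by rewrite lt_min d0 e0.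
  have [y [i _ Gy] xy] := closure_normP clx de0.
  move: xy; rewrite lt_min => /andP[xyd xye].
  exists y; split; first by exists i => //; exists y.
  by apply: dB; rewrite -ball_normE.
by exists i.
Qed.

End NormFacts.

(** * Closed sets are Caratheodory measurable *)

Section OpenCaratheodory.
Variables (R : realType) (n : nat).
Local Notation mu := (@lebesgue_outer R n.+1).

Lemma caratheodory_box (a b : 'cV[R]_n.+1) : mu.-caratheodory (box a b).
Proof.
have -> : box a b = \big[setI/setT]_(i < n.+1)
    ((~` (\bigcup_k [set x | x i 0 <= a i 0 - k.+1%:R^-1])) `&`
     [set x | x i 0 <= b i 0]).
  apply/seteqP; split=> x.
    move=> xab; elim/big_ind : _ => //= i _.
    have /andP[ax xb] := xab i; split => // -[k _ /=].
    by apply/negP; rewrite -ltNge (lt_le_trans _ ax)// ltrBlDr ltrDl invr_gt0.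
  move=> + i; rewrite (bigD1 i)//= => -[[/= axk ->] _]; rewrite andbT.
  rewrite leNgt; apply/negP => xa; apply: axk.
  have /ltr_add_invr[k xka] := xa.
  by exists k => //=; rewrite lerBrDr ltW.
elim/big_ind : _ => [|E F|i _].
- rewrite -setC0; apply: caratheodory_measurable_setC.
  exact: caratheodory_measurable_set0.
- exact: caratheodory_measurable_setI.
- apply: caratheodory_measurable_setI; last exact: caratheodory_halfspace.
  apply: caratheodory_measurable_setC; apply: caratheodory_measurable_bigcup => k.
  exact: caratheodory_halfspace.
Qed.

(** An open set is the union of the cubes with rational centre and side 2/(k+1)
    that it contains, and these are countably many. *)
Lemma caratheodory_open (U : set 'cV[R]_n.+1) : open U -> mu.-caratheodory U.
Proof.
move=> oU; pose cube (i : 'cV[rat]_n.+1 * nat) : set 'cV[R]_n.+1 :=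
  box (map_mx ratr i.1 - const_mx i.2.+1%:R^-1)
      (map_mx ratr i.1 + const_mx i.2.+1%:R^-1).
have -> : U = \bigcup_i (if `[< cube i `<=` U >] then cube i else set0).
  apply/seteqP; split=> x; last by case=> i _; case: asboolP => // h; exact: h.
  move=> Ux; have [e e0 eU] := open_normP oU Ux.
  have e20 : 0 < e / 2 by rewrite divr_gt0.
  have /ltr_add_invr[k] := e20; rewrite add0r => ke.
  have /choice[q xq] : forall i, exists q : rat, `|x i 0 - ratr q| < k.+1%:R^-1.
    move=> i; have [|q] := @rat_in_itvoo R (x i 0 - k.+1%:R^-1) (x i 0 + k.+1%:R^-1).
      by rewrite ltrBlDr -addrA ltrDl addr_gt0// invr_gt0.
    by rewrite in_itv/= => /andP[? ?]; exists q; rewrite ltr_distlC; apply/andP.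
  have xc : cube (\col_i q i, k) x.
    move=> i; rewrite !mxE/=; have := xq i.
    by rewrite -ler_distl => /ltW.
  exists (\col_i q i, k) => //; case: asboolP => // -[] y yc.
  apply: eU; apply: norm_lt_coord => // i; have := xc i; have := yc i.
  rewrite !mxE/= -!ler_distl => y1 x1.
  rewrite -(subrKA (ratr (q i))) (le_lt_trans (ler_normD _ _))//.
  by rewrite [X in _ + X]distrC (le_lt_trans (lerD x1 y1))// (splitr e) ltrD.
apply: (@countable_bigcupT_measurable _ (caratheodory_type mu)) => // i.
case: ifP => _; first exact: caratheodory_box.
exact: caratheodory_measurable_set0.
Qed.

Lemma caratheodory_closed (F : set 'cV[R]_n.+1) : closed F -> mu.-caratheodory F.
Proof.
move=> cF; rewrite -[F]setCK; apply: caratheodory_measurable_setC.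
by apply: caratheodory_open; rewrite openC.
Qed.

End OpenCaratheodory.

(** * A density criterion for null sets *)

Section NullSets.
Variables (R : realType) (n : nat).
Local Notation mu := (@lebesgue_outer R n.+1).
Implicit Types (a b : 'cV[R]_n.+1) (E U V X : set 'cV[R]_n.+1).

Lemma lebesgue_outer_finite_cover (I : finType) X (F : I -> set 'cV[R]_n.+1) :
  X `<=` \bigcup_i F i -> (mu X <= \sum_i mu (F i))%E.
Proof.
move=> XF; apply: (@le_trans _ _ (mu (\big[setU/set0]_i F i))).
  by apply: le_lebesgue_outer => x /XF[i _ Fx]; rewrite (bigD1 i)//=; left.
apply: (big_ind2 (fun E s => mu E <= s)%E) => // [|E s E' s' Es Es'].
  by rewrite lebesgue_outer0.
exact: le_trans (outer_measureU2 _ _ _) (leeD Es Es').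
Qed.

(** The volume of the enlarged box is a polynomial in the enlargement. *)
Lemma box_volume_continuous a b (e : R) : 0 < e ->
  exists2 h : R, 0 < h &
    box_volume (a - const_mx h) (b + const_mx h) <= box_volume a b + e.
Proof.
move=> e0; pose p : {poly R} := \prod_(i < n.+1) ((b i 0 - a i 0)%:P + 2%:P * 'X).
have pE h : p.[h] = box_volume (a - const_mx h) (b + const_mx h).
  rewrite horner_prod; apply: eq_bigr => i _; rewrite !mxE !hornerE.
  by ring.
have /cvgrPdist_lt/(_ e e0)/nbhs_ballP[d /= d0 hd] := @continuous_horner R p 0.
exists (d / 2); first by rewrite divr_gt0.
have := hd (d / 2); rewrite -ball_normE/= sub0r normrN gtr0_norm ?divr_gt0//.
move=> /(_ ltac:(lra)); rewrite !pE => /ltr_distlCDr/ltW.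
rewrite (_ : box_volume (a - const_mx 0) (b + const_mx 0) = box_volume a b)//.
by rewrite /box_volume; apply: eq_bigr => i _; rewrite !mxE subr0 addr0.
Qed.

Lemma mulmx_expV (F : fieldType) p (B : 'M[F]_p.+1) m : B \in unitmx ->
  B ^+ m *m invmx B ^+ m = 1%:M.
Proof. by move=> Bu; rewrite -[invmx B]/(B^-1) exprVn; apply/mulrV/unitrX. Qed.

(** The complement U of V contains a ball around 0 and is periodic, so finitely
    many, say M, translates of U cover the space; applying B^m, so do M
    translates of B^m U by arbitrarily small vectors, and B^m U is contained in
    U.  Hence U takes up at least the proportion 1/M of each box, up to an
    enlargement of the box that tends to 0.  The part of V in each box of a
    cover of E then has measure at most 1 - 1/M times the volume of that box,
    which forces the finite number mu E to be at most (1 - 1/M) mu E. *)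
Lemma null_of_invariant (B : 'M[R]_n.+1) V : B \in unitmx ->
    (forall t : 'cV[R]_n.+1, forall e : R, 0 < e ->
      \forall m \near \oo, `|B ^+ m *m t| < e) ->
    closed V -> ~ V 0 ->
    (forall x (k : 'cV[int]_n.+1), V (x + map_mx intr k) -> V x) ->
    (forall x, V (B *m x) -> V x) ->
  forall E a b, E `<=` V -> E `<=` box a b -> mu E = 0%E.
Proof.
move=> Bunit Bcvg clV V0 Vper VB.
have oU : open (~` V) by rewrite openC.
have [r r0 rU] := open_normP oU V0.
have /ltr_add_invr[L] := r0; rewrite add0r => Lr.
pose I : finType := {ffun 'I_n.+1 -> 'I_L.+1}.
(* Since 1 / (L + 1) < r, modulo the lattice every point is within r of some t j. *)
pose t (j : I) : 'cV[R]_n.+1 := \col_i ((j i)%:R / L.+1%:R).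
have tcov x : exists j, ~ V (x - t j).
  pose z i := Num.floor (L.+1%:R * x i 0).
  have zL i : (`|(z i %% L.+1)%Z| < L.+1)%N.
    by rewrite -ltz_nat gez0_abs ?modz_ge0// ltz_pmod.
  exists [ffun i => Ordinal (zL i)] => Vx.
  pose k : 'cV[int]_n.+1 := \col_i (z i %/ L.+1)%Z.
  apply: (rU (x - t [ffun i => Ordinal (zL i)] - map_mx intr k)); last first.
    by apply: (Vper _ k); rewrite subrK.
  rewrite sub0r normrN; apply: norm_lt_coord => // i.
  rewrite !mxE ffunE/= pmulrn gez0_abs ?modz_ge0//.
  have -> : x i 0 - ((z i %% L.+1)%Z)%:~R / L.+1%:R - (z i %/ L.+1)%Z%:~R =
      (L.+1%:R * x i 0 - (z i)%:~R) / L.+1%:R.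
    have -> : (z i)%:~R = (z i %/ L.+1)%Z%:~R * L.+1%:R + (z i %% L.+1)%Z%:~R :> R.
      by rewrite {1}(divz_eq (z i) L.+1) rmorphD rmorphM.
    have L0 : L.+1%:R != 0 :> R by rewrite pnatr_eq0.
    by field.
  have /andP[z1 z2] := floor_itv (L.+1%:R * x i 0).
  rewrite normrM normfV !ger0_norm ?subr_ge0//.
  apply: lt_trans Lr; rewrite -[ltRHS]mul1r ltr_pM2r ?invr_gt0//.
  by rewrite ltrBlDl -intrD1.
have VBm m x : V (B ^+ m *m x) -> V x.
  by elim: m x => [|m IH] x; [rewrite mul1mx|rewrite exprS -mulmxA => /VB/IH].
pose M : R := #|I|%:R.
have M0 : 0 < M by rewrite ltr0n; apply/card_gt0P; exists [ffun=> ord0].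
have box_part a b : (forall i, a i 0 <= b i 0) ->
    (mu (V `&` box a b) <= ((1 - M^-1) * box_volume a b)%:E)%E.
  move=> ab.
  have fin : mu (V `&` box a b) \is a fin_num.
    rewrite ge0_fin_numE ?lebesgue_outer_ge0//.
    rewrite (le_lt_trans (le_lebesgue_outer (@subIsetr _ _ _)))//.
    by rewrite lebesgue_outer_box ?ltry.
  rewrite -(fineK fin) lee_fin.
  suff : M * fine (mu (V `&` box a b)) + box_volume a b <= M * box_volume a b.
    move=> h; rewrite -(ler_pM2l M0) mulrA mulrBr mulr1 mulfV ?gt_eqF//.
    by rewrite mulrBl mul1r lerBrDr.
  apply/ler_addgt0Pr => e e0.
  (* The box is enlarged by h to absorb the translations by B^m t. *)
  have [h h0 he] := box_volume_continuous a b (divr_gt0 e0 M0).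
  set a' := a - const_mx h in he; set b' := b + const_mx h in he.
  have ab' i : a' i 0 <= b' i 0 by rewrite !mxE; have := ab i; lra.
  have [m mh] : exists m, forall j : I, `|B ^+ m *m t j| < h.
    have : \forall m \near \oo, forall j : I, `|B ^+ m *m t j| < h.
      exact: filter_forall (fun j => Bcvg (t j) h h0).
    by case/filter_ex => m; exists m.
  have Ubox : (mu (box a b) <= \sum_(j : I) mu (~` V `&` box a' b'))%E.
    apply: le_trans (lebesgue_outer_finite_cover (F := fun j : I =>
      [set y + B ^+ m *m t j | y in ~` V `&` box a' b']) _) _.
      move=> x xab; have [j Vj] := tcov (invmx B ^+ m *m x).
      exists j => //; exists (x - B ^+ m *m t j); last by rewrite subrK.
      split.
        move=> Vx; apply: Vj; apply: (VBm m).
        by rewrite mulmxBr mulmxA mulmx_expV// mul1mx.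
      move=> i; rewrite !mxE; have := xab i; have := coord_le_norm (B ^+ m *m t j) i.
      by move/le_lt_trans/(_ (mh j)); rewrite ltr_norml mxE => /andP[? ?] /andP[? ?]; lra.
    by apply: lee_sum => j _; exact: lebesgue_outer_shift.
  have Usum : (\sum_(j : I) mu (~` V `&` box a' b') = M%:E * mu (~` V `&` box a' b'))%E.
    rewrite big_const /M; elim: #|I| => [|k IH]; first by rewrite mul0e.
    by rewrite iterS IH mulrS EFinD ge0_muleDl ?lee_fin// mul1e.
  have : (M%:E * mu (V `&` box a b) + mu (box a b) <= M%:E * mu (box a' b'))%E.
    rewrite [in leRHS](caratheodory_closed clV (box a' b')).
    rewrite muleDr// ?ge0_adde_def ?inE ?lebesgue_outer_ge0//.
    rewrite leeD//.
      rewrite lee_wpmul2l ?lee_fin ?(ltW M0)// setIC; apply: le_lebesgue_outer.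
      apply: setSI => x xab i; have := xab i; rewrite !mxE => /andP[? ?]; lra.
    by rewrite (le_trans Ubox)// Usum setIC.
  rewrite -(fineK fin) !lebesgue_outer_box// -!EFinM -EFinD lee_fin => /le_trans; apply.
  apply: le_trans (ler_wpM2l (ltW M0) he) _.
  by rewrite mulrDr mulrCA mulfV ?gt_eqF// mulr1.
move=> E a b EV Eab; apply/eqP; rewrite eq_le lebesgue_outer_ge0 andbT.
have Eoo : (mu E < +oo)%E.
  have [ab|nab] := pselect (forall i, a i 0 <= b i 0).
    by rewrite (le_lt_trans (le_lebesgue_outer Eab))// lebesgue_outer_box ?ltry.
  suff -> : E = set0 by rewrite lebesgue_outer0.
  rewrite -subset0 => x /Eab xab; apply: nab => i.
  by have /andP[] := xab i; exact: le_trans.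
have q0 : 0 <= 1 - M^-1 by rewrite subr_ge0 invf_le1// ler1n; move: M0; rewrite ltr0n.
have EE (e : R) : 0 < e -> (mu E <= (1 - M^-1)%:E * (mu E + e%:E))%E.
  move=> e0; have [c cE ce] := lebesgue_outer_cover Eoo e0.
  apply: le_trans (lee_wpmul2l _ ce); last by rewrite lee_fin.
  have Ecov : E `<=` \bigcup_k (V `&` box (c k).1 (c k).2).
    by move=> x Ex; have [k _ xk] := cE.2 x Ex; exists k => //; split=> //; exact: EV.
  apply: le_trans (le_lebesgue_outer Ecov) _.
  apply: le_trans (lebesgue_outer_sigma_subadditive _) _.
  rewrite /cover_sum -nneseriesZl; last first.
    by move=> k _; rewrite lee_fin box_volume_ge0//; exact: cE.1.
  apply: lee_nneseries => [k _ _|k _]; first exact: lebesgue_outer_ge0.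
  by rewrite -EFinM; apply: box_part; exact: cE.1.
have fin : mu E \is a fin_num by rewrite ge0_fin_numE ?lebesgue_outer_ge0.
rewrite -(fineK fin) lee_fin.
have M1 : 0 < M^-1 by rewrite invr_gt0.
suff : fine (mu E) * M^-1 <= 0 by rewrite pmulr_lle0.
apply/ler_addgt0Pr => e e0; have := EE e e0; rewrite -{1 2}(fineK fin) -EFinD -EFinM lee_fin.
have : (1 - M^-1) * e <= e by rewrite ler_piMl ?(ltW e0)// gerBl ltW.
by rewrite add0r mulrDr; lra.
Qed.

End NullSets.

(** * Decay of the powers of the inverse matrix *)

Section PowerDecay.
Variables (C : numClosedFieldType) (n : nat).
Implicit Types (B Q : 'M[C]_n.+1) (s : seq C) (l r : C).

(** The constant is chosen so that c + l K <= r K, which makes the induction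
    close. *)
Lemma recurrence_decay (a b : nat -> C) (z l r c : C) :
    0 <= l -> l < r -> `|z| <= l -> 0 <= c ->
    (forall m, a m.+1 = b m + z * a m) -> (forall m, `|b m| <= c * r ^+ m) ->
  forall m, `|a m| <= (`|a 0| + c / (r - l)) * r ^+ m.
Proof.
move=> l0 lr zl c0 ab bc; have r0 : 0 <= r by exact: le_trans (ltW lr).
have rl : 0 < r - l by rewrite subr_gt0.
set K := `|a 0| + _; have Kc : c <= (r - l) * K.
  by rewrite mulrDr mulrCA mulfV ?gt_eqF// mulr1 lerDr mulr_ge0// ltW.
have K0 : 0 <= K by rewrite addr_ge0// divr_ge0// ltW.
elim=> [|m IH]; first by rewrite expr0 mulr1 lerDl divr_ge0// ltW.
rewrite ab (le_trans (ler_normD _ _))// normrM.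
apply: (@le_trans _ _ ((r - l) * K * r ^+ m + l * (K * r ^+ m))).
  apply: lerD; last by apply: ler_pM.
  by apply: le_trans (bc m) _; rewrite ler_wpM2r// exprn_ge0.
by rewrite exprS -mulrA -mulrDl subrK mulrCA.
Qed.

(** The factor Q lets the decay of B^m be reached one linear factor B - z of the
    characteristic polynomial at a time. *)
Definition decays r B Q :=
  exists2 K, 0 <= K & forall m i j, `|(B ^+ m * Q) i j| <= K * r ^+ m.

(** Each entry of B^m Q satisfies the recurrence a (m + 1) = b m + z a m, where b
    is the same entry of B^m (B - z) Q. *)
Lemma decays_factor r l z B Q : 0 <= l -> l < r -> `|z| <= l ->
  decays r B ((B - z%:M) * Q) -> decays r B Q.
Proof.
move=> l0 lr zl [c c0 bc].
have r0 : 0 <= r by exact: le_trans (ltW lr).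
exists (\sum_i \sum_j `|Q i j| + c / (r - l)).
  by rewrite addr_ge0 ?divr_ge0 ?subr_ge0 ?(ltW lr)// sumr_ge0// => i _; rewrite sumr_ge0.
move=> m i j; pose a k := (B ^+ k * Q) i j.
apply: le_trans (@recurrence_decay a (fun k => (B ^+ k * ((B - z%:M) * Q)) i j)
  z l r c l0 lr zl c0 _ (fun k => bc k i j) m) _.
  move=> k; rewrite /a mulrBl mulrBr mulrA -exprSr.
  have -> : z%:M * Q = z *: Q by exact: mul_scalar_mx.
  by rewrite -scalerAr !mxE subrK.
rewrite ler_wpM2r ?exprn_ge0// lerD2r /a expr0 mul1r.
rewrite (bigD1 i)//= (bigD1 j)//= -addrA lerDl.
by rewrite addr_ge0// sumr_ge0// => k _; rewrite sumr_ge0.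
Qed.

Lemma decays_prod r l s B Q : 0 <= l -> l < r ->
    (forall z, z \in s -> `|z| <= l) ->
  decays r B ((\prod_(z <- s) (B - z%:M)) * Q) -> decays r B Q.
Proof.
move=> l0 lr; elim: s => [|z s IH] sl; first by rewrite big_nil mul1r.
rewrite big_cons -mulrA => /(decays_factor l0 lr (sl z (mem_head _ _))).
by apply: IH => y ys; apply: sl; rewrite inE ys orbT.
Qed.

Lemma normr_max_lt1 s : (forall z, z \in s -> `|z| < 1) ->
  exists l : C, [/\ 0 <= l, l < 1 & forall z, z \in s -> `|z| <= l].
Proof.
elim: s => [|z s IH] s1; first by exists 0.
have [|l [l0 l1 sl]] := IH; first by move=> y ys; apply: s1; rewrite inE ys orbT.
have z1 := s1 z (mem_head _ _).
have [zl|lz] := real_leP (normr_real z) (ger0_real l0).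
  by exists l; split=> // y; rewrite inE => /predU1P[->|/sl].
exists `|z|; split=> // y; rewrite inE => /predU1P[->//|/sl yl].
exact: le_trans (ltW lz).
Qed.

(** By Cayley-Hamilton the product of the B - z over the roots z of the
    characteristic polynomial, with multiplicity, is 0, which certainly decays;
    the factors are then removed one by one. *)
Lemma power_decay B : (forall z, eigenvalue B z -> `|z| < 1) ->
  exists r : C, [/\ 0 < r, r < 1 & decays r B 1].
Proof.
move=> eigB; have [s sE] := closed_field_poly_normal (char_poly B).
move: sE; rewrite (monicP (char_poly_monic B)) scale1r => sE.
have [l [l0 l1 sl]] : exists l : C, [/\ 0 <= l, l < 1 & forall z, z \in s -> `|z| <= l].
  apply: normr_max_lt1 => z zs; apply: eigB.
  by rewrite eigenvalue_root_char sE root_prod_XsubC.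
exists ((l + 1) / 2); have lr : l < (l + 1) / 2 by rewrite midf_lt.
split; [exact: le_lt_trans lr|by rewrite midf_lt|].
apply: (decays_prod l0 lr sl); exists 0 => // m i j.
have -> : \prod_(z <- s) (B - z%:M) = horner_mx B (char_poly B).
  rewrite sE rmorph_prod; apply: eq_bigr => z _.
  by rewrite rmorphB/= horner_mx_X horner_mx_C.
by rewrite Cayley_Hamilton mul0r mulr0 mxE normr0 mul0r.
Qed.

End PowerDecay.

Section Dilation.
Variables (R : realType) (n : nat) (A : 'M[int]_n.+1).
Hypothesis hA : dilation_matrix R A.

Let AR : 'M[R]_n.+1 := map_mx intr A.
Let AC : 'M[R[i]]_n.+1 := map_mx intr A.

Lemma dilation_det : \det A != 0.
Proof.
apply/negP => /eqP detA.
have : \det AC = 0 by rewrite det_map_mx detA.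
move/eqP/det0P => [v v0 vA]; have : eigenvalue AC 0.
  by apply/eigenvalueP; exists v; rewrite ?scale0r.
by move/hA; rewrite normr0 ltr10.
Qed.

Lemma dilation_unit : AR \in unitmx.
Proof. by rewrite unitmxE det_map_mx unitfE intr_eq0 dilation_det. Qed.

(** The eigenvalues of the inverse are the inverses of those of A, so they lie in
    the open unit disc; the bound obtained over the complex numbers has real
    constants. *)
Lemma dilation_power_decay : exists K r : R,
  [/\ 0 <= K, 0 < r, r < 1 &
    forall m (x : 'cV[R]_n.+1), `|invmx AR ^+ m *m x| <= K * r ^+ m * `|x|].
Proof.
pose toC : R -> R[i] := real_complex R.
have ACE : AC = map_mx toC AR.
  by apply/matrixP => i j; rewrite !mxE /toC rmorph_int.
have [|r [r0 r1 [K K0 BK]]] := @power_decay _ _ (map_mx toC (invmx AR)).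
  move=> z /eigenvalueP[v vB v0].
  have vA : v = z *: (v *m AC).
    rewrite ACE scalemxAl -vB -mulmxA -map_mxM mulVmx ?dilation_unit//.
    by rewrite map_mx1 mulmx1.
  have z0 : z != 0.
    by apply: contra_neq v0 => z0; rewrite vA z0 scale0r.
  have /hA : eigenvalue AC z^-1.
    by apply/eigenvalueP; exists v => //; rewrite {2}vA scalerA mulVf// scale1r.
  by rewrite normfV invf_gt1// normr_gt0.
have rE : (complex.Re r)%:C%C = r by apply: RRe_real; apply: gtr0_real.
have KE : (complex.Re K)%:C%C = K by apply: RRe_real; apply: ger0_real.
exists (n.+1%:R * complex.Re K), (complex.Re r); split.
- by rewrite mulr_ge0//; move: K0; rewrite -KE ler0c.
- by move: r0; rewrite -rE (ltcR 0).
- by move: r1; rewrite -rE ltcR.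
have BR m i j : `|(invmx AR ^+ m) i j| <= complex.Re K * complex.Re r ^+ m.
  rewrite -lecR rmorphM rmorphXn /= KE rE.
  have := BK m i j; rewrite mulr1 -(rmorphXn (map_mx toC)) mxE.
  by rewrite normc_def/= expr0n addr0 sqrtr_sqr.
move=> m x; have c0 : 0 <= complex.Re K * complex.Re r ^+ m.
  exact: le_trans (BR m ord0 ord0).
apply: norm_le_coord; first by rewrite mulr_ge0// -mulrA mulr_ge0.
move=> i; rewrite mxE (le_trans (ler_norm_sum _ _ _))//.
apply: (@le_trans _ _ (\sum_(j < n.+1) complex.Re K * complex.Re r ^+ m * `|x|)).
  apply: ler_sum => j _; rewrite normrM ler_pM//; exact: coord_le_norm.
by rewrite sumr_const card_ord -!mulrA mulr_natl.
Qed.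

End Dilation.

(** * Matrices acting on the normed space *)

Section Preliminaries.
Variables (R : realType) (n : nat).

Lemma mulmx_norm_bound (M : 'M[R]_n.+1) :
  exists2 c : R, 0 < c & forall x : 'cV[R]_n.+1, `|M *m x| <= c * `|x|.
Proof.
exists (1 + \sum_i \sum_j `|M i j|).
  by rewrite ltr_wpDr// sumr_ge0// => i _; rewrite sumr_ge0.
move=> x; have s0 : 0 <= \sum_i \sum_j `|M i j|.
  by rewrite sumr_ge0// => i _; rewrite sumr_ge0.
apply: norm_le_coord; first by rewrite mulr_ge0// addr_ge0.
move=> i; rewrite mxE (le_trans (ler_norm_sum _ _ _))//.
apply: (@le_trans _ _ ((\sum_j `|M i j|) * `|x|)).
  rewrite mulr_suml; apply: ler_sum => j _.
  by rewrite normrM ler_wpM2l//; exact: coord_le_norm.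
rewrite ler_wpM2r// [X in _ <= _ + X](bigD1 i)//= addrCA lerDl addr_ge0//.
by rewrite sumr_ge0// => k _; rewrite sumr_ge0.
Qed.

Lemma closed_affine_preimage (M : 'M[R]_n.+1) (v : 'cV[R]_n.+1)
    (F : set 'cV[R]_n.+1) : closed F -> closed [set x | F (M *m x + v)].
Proof.
have [c c0 Mc] := mulmx_norm_bound M.
move=> clF; apply: closed_normP => x xF /=.
apply: contrapT => nFx; have oF : open (~` F) by rewrite openC.
have [e e0 eF] := open_normP oF nFx.
have [y /= Fy xy] := xF (e / c) (divr_gt0 e0 c0).
apply: (eF (M *m y + v)) => //.
rewrite opprD addrACA subrr addr0 -mulmxBr (le_lt_trans (Mc _))//.
by rewrite mulrC -ltr_pdivlMr.
Qed.

Lemma finite_int_ball (r : R) :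
  finite_set [set z : 'cV[int]_n.+1 | `|map_mx intr z : 'cV[R]_n.+1| <= r].
Proof.
have [N rN] : exists N : nat, r < N%:R.
  by exists (Num.truncn r).+1; exact: truncnS_gt.
pose g (f : 'cV['I_(N + N).+1]_n.+1) : 'cV[int]_n.+1 :=
  \col_i ((f i ord0 : nat)%:Z - N%:Z).
apply: sub_finite_set (finite_image g (@finite_finset _ setT)).
move=> z /= zr; exists (\col_i inord (absz (z i 0 + N%:Z))) => //.
apply/colP => i; rewrite !mxE.
have /ltW : `|(z i 0)%:~R : R| < N%:R.
  apply: le_lt_trans rN; apply: le_trans zr.
  by have := coord_le_norm (map_mx intr z : 'cV[R]_n.+1) i; rewrite mxE.
rewrite -intr_norm pmulrn ler_int => zN.
by rewrite inordK; lia.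
Qed.

End Preliminaries.

(** * Digits and the quotient map *)

Section Digits.
Variables (n : nat) (A : 'M[int]_n.+1) (D : set 'cV[int]_n.+1).
Hypotheses (detA : \det A != 0) (hD : digit_set A D).
Implicit Types x y d : 'cV[int]_n.+1.

Lemma mulmx_det_inj x y : A *m x = A *m y -> x = y.
Proof.
move=> /(congr1 (mulmx (\adj A))); rewrite !mulmxA mul_adj_mx !mul_scalar_mx.
move=> /colP xy; apply/colP => i; have := xy i; rewrite !mxE.
exact: mulfI.
Qed.

Lemma digit_unique d1 d2 x y : D d1 -> D d2 -> d1 + A *m x = d2 + A *m y ->
  d1 = d2 /\ x = y.
Proof.
move=> Dd1 Dd2 dxy; have [d [_ du]] := hD.2 (d1 + A *m x).
have d12 : d1 = d2.
  rewrite -(du d1); last by split=> //; exists x.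
  by apply: du; split=> //; exists y.
by split=> //; apply: mulmx_det_inj; move: dxy; rewrite d12 => /addrI.
Qed.

Lemma digit_quotient_ex x : exists p : 'cV[int]_n.+1 * 'cV[int]_n.+1,
  D p.1 /\ x = p.1 + A *m p.2.
Proof. by have [d [[Dd [y xE]] _]] := hD.2 x; exists (d, y). Qed.

Definition digit x := (sval (cid (digit_quotient_ex x))).1.
Definition quotient x := (sval (cid (digit_quotient_ex x))).2.

Lemma digitP x : D (digit x).
Proof. by rewrite /digit; case: cid => ? []. Qed.

Lemma digit_quotientE x : x = digit x + A *m quotient x.
Proof. by rewrite /digit /quotient; case: cid => ? []. Qed.

Lemma quotientE d y : D d -> quotient (d + A *m y) = y.
Proof.
move=> Dd.
by have [_ /esym] := digit_unique Dd (digitP (d + A *m y)) (digit_quotientE _).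
Qed.

Lemma quotient0 : quotient 0 = 0.
Proof. by have := quotientE 0 hD.1; rewrite mulmx0 addr0. Qed.

(** As det A times any integer vector lies in the image of A, the digit of x only
    depends on x modulo det A. *)
Lemma digits_finite : finite_set D.
Proof.
pose q := `|\det A|%N.
have q0 : (0 < q)%N by rewrite absz_gt0.
pose g (f : 'cV['I_q]_n.+1) : 'cV[int]_n.+1 := digit (\col_i (f i ord0 : nat)%:Z).
apply: sub_finite_set (finite_image g (@finite_finset _ setT)) => d Dd.
have dq i : (`|(d i ord0 %% \det A)%Z| < q)%N.
  by rewrite -ltz_nat gez0_abs ?modz_ge0// ltz_mod.
exists (\col_i Ordinal (dq i)) => //; rewrite /g.
set x := (X in digit X).
have xE : x = d + A *m (- \adj A *m \col_i (d i ord0 %/ \det A)%Z).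
  rewrite mulNmx mulmxN mulmxA mul_mx_adj mul_scalar_mx; apply/colP => i.
  rewrite !mxE /= gez0_abs ?modz_ge0// {2}(divz_eq (d i 0) (\det A)).
  by rewrite mulrC addrAC subrr add0r.
by have [] := digit_unique (digitP x) Dd (etrans (esym (digit_quotientE x)) xE).
Qed.

Lemma radix_expansion x N :
  x = \sum_(j < N) A ^+ j *m digit (iter j quotient x) + A ^+ N *m iter N quotient x.
Proof.
elim: N => [|N IH]; first by rewrite big_ord0 add0r mul1mx.
rewrite {1}IH big_ord_recr/= -addrA; congr (_ + _).
by rewrite {1}(digit_quotientE (iter N _ _)) mulmxDr exprSr mulmxA.
Qed.

(** The digits of a radix expansion are unique, so each application of the
    quotient map removes the lowest one. *)
Lemma iter_quotient_sum N (d : nat -> 'cV[int]_n.+1) :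
    (forall j, (j < N)%N -> D (d j)) ->
  iter N quotient (\sum_(j < N) A ^+ j *m d j) = 0.
Proof.
elim: N d => [|N IH] d Dd; first by rewrite big_ord0.
rewrite iterSr big_ord_recl mul1mx.
have -> : \sum_(i < N) A ^+ lift ord0 i *m d (lift ord0 i) =
    A *m \sum_(i < N) A ^+ i *m d i.+1.
  by rewrite mulmx_sumr; apply: eq_bigr => i _; rewrite lift0 exprS mulmxA.
rewrite quotientE; last exact: Dd.
by apply: (IH (fun j => d j.+1)) => j jN; exact: Dd.
Qed.

Lemma radix_iff_nilpotent : yields_radix_representation A D <->
  forall x, exists N, iter N quotient x = 0.
Proof.
split=> [rad x|nil x].
  have [N [d [Dd xE]]] := rad x; exists N.+1.
  rewrite xE -[RHS](@iter_quotient_sum N.+1 (fun j => d (inord j))) //.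
  by congr iter; apply: eq_bigr => i _; rewrite inord_val.
have [N xN] := nil x.
exists N, (fun j : 'I_N.+1 => digit (iter j quotient x)); split=> [j|].
  exact: digitP.
by rewrite {1}(radix_expansion x N.+1) iterS xN quotient0 mulmx0 addr0.
Qed.

End Digits.

(** * The tile as a maximal set *)

Section Tile.
Variables (R : realType) (n : nat) (A : 'M[int]_n.+1) (D : set 'cV[int]_n.+1).
Hypotheses (hA : dilation_matrix R A) (hD : digit_set A D).

Local Notation ι := (map_mx intr : 'cV[int]_n.+1 -> 'cV[R]_n.+1).
Local Notation AR := (map_mx intr A : 'M[R]_n.+1).
Local Notation B := (invmx AR).
Local Notation T := (digit_tile R A D).

Let detA := dilation_det hA.
Let Aunit := dilation_unit hA.

Local Notation dig := (digit hD).
Local Notation quo := (quotient hD).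

Lemma intr_expansion (d y : 'cV[int]_n.+1) : ι (d + A *m y) = ι d + AR *m ι y.
Proof. by rewrite map_mxD map_mxM. Qed.

Lemma mulAB (x : 'cV[R]_n.+1) : AR *m (B *m x) = x.
Proof. by rewrite mulmxA mulmxV// mul1mx. Qed.

Lemma mulBA (x : 'cV[R]_n.+1) : B *m (AR *m x) = x.
Proof. by rewrite mulmxA mulVmx// mul1mx. Qed.

Lemma expBA m : B ^+ m *m AR ^+ m = 1%:M.
Proof. by have := @mulmx_expV _ _ B m; rewrite invmxK unitmx_inv; exact. Qed.

Lemma power_bound : exists2 K : R, 0 < K &
  forall m (x : 'cV[R]_n.+1), `|B ^+ m *m x| <= K * `|x|.
Proof.
have [K [r [K0 r0 r1 Kr]]] := dilation_power_decay hA.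
exists (K + 1); first by rewrite ltr_wpDl.
move=> m x; apply: le_trans (Kr m x) _; rewrite ler_wpM2r//.
by rewrite (@le_trans _ _ K) ?lerDl// ler_piMr// exprn_ile1// ltW.
Qed.

Lemma power_cvg0 (M e : R) : 0 <= M -> 0 < e ->
  \forall m \near \oo, forall t : 'cV[R]_n.+1, `|t| <= M -> `|B ^+ m *m t| < e.
Proof.
move=> M0 e0; have [K [r [K0 r0 r1 Kr]]] := dilation_power_decay hA.
have c0 : 0 < K * M + 1 by rewrite ltr_wpDl// mulr_ge0.
have rcvg : r ^+ m @[m --> \oo] --> 0 by apply: cvg_expr; rewrite gtr0_norm.
have /cvgrPdist_lt/(_ _ (divr_gt0 e0 c0)) := rcvg.
apply: filterS => m; rewrite sub0r normrN gtr0_norm ?exprn_gt0// => rm t tM.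
apply: le_lt_trans (Kr m t) _; rewrite mulrAC.
move: rm; rewrite ltr_pdivlMr// mulrC; apply: le_lt_trans.
rewrite ler_wpM2r ?exprn_ge0 ?(ltW r0)//.
by rewrite (@le_trans _ _ (K * M)) ?lerDl// ler_wpM2l.
Qed.

Definition tile_sum (d : nat -> 'cV[int]_n.+1) N : 'cV[R]_n.+1 :=
  \sum_(1 <= j < N.+1) B ^+ j *m ι (d j).

Lemma tile_sumS d N : tile_sum d N.+1 =
  B *m (ι (d 1%N) + tile_sum (fun j => d j.+1) N).
Proof.
rewrite /tile_sum big_nat_recl// expr1 mulmxDr; congr (_ + _).
rewrite mulmx_sumr; apply: eq_bigr => j _.
by rewrite exprS mulmxA.
Qed.

Lemma digits_bound : exists2 M : R, 0 <= M & forall d, D d -> `|ι d| <= M.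
Proof.
have [s sD] := (finite_seqP D).1 (digits_finite detA hD).
exists (\sum_(d <- s) `|ι d|); first by rewrite sumr_ge0.
move=> d; rewrite sD /= => ds.
by rewrite (big_rem d ds)//= lerDl sumr_ge0.
Qed.

Lemma tile_bounded : exists2 M : R, 0 < M & forall x, T x -> `|x| <= M.
Proof.
have [K [r [K0 r0 r1 Kr]]] := dilation_power_decay hA.
have [M M0 DM] := digits_bound.
have s0 : 0 < 1 - r by rewrite subr_gt0.
exists (K * M / (1 - r) + 1) => [|x [d [Dd dx]]].
  by rewrite ltr_wpDl// divr_ge0 ?mulr_ge0// ltW.
have sumM N : `|tile_sum d N| <= K * M / (1 - r).
  apply: le_trans (ler_norm_sum _ _ _) _.
  apply: (@le_trans _ _ (\sum_(0 <= j < N.+1) K * M * r ^+ j)).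
    rewrite [leRHS]big_nat_recl//= -[leLHS]add0r lerD//.
      by rewrite !mulr_ge0// exprn_ge0// ltW.
    rewrite big_add1/= big_nat_cond [leRHS]big_nat_cond; apply: ler_sum => j _.
    apply: le_trans (Kr _ _) _; rewrite mulrAC ler_wpM2r ?exprn_ge0 ?(ltW r0)//.
    by rewrite ler_wpM2l//; apply: DM; exact: Dd.
  rewrite -mulr_sumr ler_wpM2l ?mulr_ge0//.
  rewrite -[leRHS]mul1r ler_pdivlMr// mulrC big_mkord -opprB mulNr -subrX1.
  by rewrite opprB gerBl exprn_ge0// ltW.
have /cvgrPdist_lt/(_ 1 ltr01)/filter_ex[N] := dx; rewrite -/(tile_sum d N) => xN.
rewrite -[x](subrK (tile_sum d N)) addrC (le_trans (ler_normD _ _))// addrC.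
by rewrite [leRHS]addrC lerD// ltW.
Qed.

(** Choosing digits greedily inside X writes x as a partial digit sum plus B^m y
    with y in X; since X is bounded, the remainder tends to 0. *)
Lemma tile_maximal (X : set 'cV[R]_n.+1) (M : R) :
    (forall x, X x -> `|x| <= M) ->
    (forall x, X x -> exists2 d, D d & X (AR *m x - ι d)) ->
  X `<=` T.
Proof.
move=> XM Xstep x Xx.
have /choice[f fX] : forall y, exists d, X y -> D d /\ X (AR *m y - ι d).
  move=> y; have [/Xstep[d Dd Xd]|nX] := pselect (X y); first by exists d.
  by exists 0.
pose y k := iter k (fun z => AR *m z - ι (f z)) x.
have Xy k : X (y k) by elim: k => [//|k IH]; have [] := fX _ IH.
pose d k := f (y k.-1).
exists d; split=> [[//|j] _|]; first by have [] := fX _ (Xy j).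
have xE N : x = tile_sum d N + B ^+ N *m y N.
  elim: N => [|N IH]; first by rewrite /tile_sum big_geq// add0r mul1mx.
  rewrite /tile_sum big_nat_recr//= {1}IH -addrA; congr (_ + _).
  by rewrite exprSr -mulmxDr /= addrC /d/= subrK -mulmxA mulBA.
apply/cvgrPdist_lt => e e0.
have M0 : 0 <= M by exact: le_trans (XM x Xx).
apply: filterS (power_cvg0 M0 e0) => m small.
by rewrite -/(tile_sum d m) {1}(xE m) addrC addKr small// XM.
Qed.

Lemma tile_expand x : T x -> exists2 d, D d & T (AR *m x - ι d).
Proof.
move=> [d [Dd dx]]; exists (d 1%N); first exact: Dd.
exists (fun j => d j.+1); split=> [j _|]; first exact: Dd.
have [c c0 Ac] := mulmx_norm_bound AR.
apply/cvgrPdist_lt => e e0.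
have dxS : tile_sum d N.+1 @[N --> \oo] --> x by rewrite (cvg_shiftS (tile_sum d)).
have /cvgrPdist_lt/(_ _ (divr_gt0 e0 c0)) := dxS.
apply: filterS => N; rewrite tile_sumS -/(tile_sum (fun j => d j.+1) N) => xN.
rewrite -addrA -opprD -[_ + tile_sum _ _]mulAB -mulmxBr.
by rewrite (le_lt_trans (Ac _))// mulrC -ltr_pdivlMr.
Qed.

Lemma tile0 : T 0.
Proof.
have := @tile_maximal [set 0] 0; apply=> // _ ->; first by rewrite normr0.
by exists 0; [exact: hD.1|rewrite mulmx0 map_mx0 subr0].
Qed.

(** Adding this one point to T keeps the expansion property of T, so by
    maximality it was there already. *)
Lemma tile_contract x d : T x -> D d -> T (B *m (x + ι d)).
Proof.
move=> Tx Dd; have [M M0 TM] := tile_bounded.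
have := @tile_maximal (T `|` [set B *m (x + ι d)]) (M + `|B *m (x + ι d)|).
apply; last by right.
- move=> y [/TM yM|->]; last by rewrite lerDr ltW.
  by rewrite (le_trans yM)// lerDl.
- move=> y [/tile_expand[d' Dd' Td']|->]; first by exists d' => //; left.
  by exists d => //; left; rewrite mulAB addrK.
Qed.

Lemma tile_contract_quotient x k : T (x - ι k) -> T (B *m x - ι (quo k)).
Proof.
move=> /tile_contract/(_ (digitP hD k)).
rewrite {1}(digit_quotientE hD k) intr_expansion opprD addrA addrAC subrK.
by rewrite mulmxBr mulBA.
Qed.

(** The closure of T inherits the expansion property because there are only
    finitely many digits, so maximality applies to it. *)
Lemma tile_closed : closed T.
Proof.
have [M M0 TM] := tile_bounded.
apply/closure_id/esym/seteqP; split; last exact: subset_closure.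
apply: (@tile_maximal _ (M + 1)) => [x /closure_normP/(_ ltr01)[y Ty xy]|x].
  rewrite -[x](subrK y) (le_trans (ler_normD _ _))// addrC lerD//; last exact: ltW.
  exact: TM.
have clU : closed (\bigcup_(d in D) [set x | closure T (AR *m x - ι d)]).
  apply: closed_bigcup; first exact: digits_finite detA hD.
  by move=> d _; apply: closed_affine_preimage; exact: closed_closure.
move=> Tx; suff [d Dd Td] : (\bigcup_(d in D) [set x | closure T (AR *m x - ι d)]) x.
  by exists d.
rewrite ((closure_id _).1 clU); apply: closureS Tx => y /tile_expand[d Dd Td].
by exists d => //; exact: subset_closure.
Qed.

(** * Integer translates of the tile *)

(** The translate by k as a preimage, which makes it visibly closed. *)
Definition shifted (k : 'cV[int]_n.+1) : set 'cV[R]_n.+1 := [set x | T (x - ι k)].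

Lemma translateE k : translate T k = shifted k.
Proof.
apply/seteqP; split=> [_ [x Tx <-]|x Tx]; first by rewrite /shifted/= addrK.
by exists (x - ι k) => //; rewrite subrK.
Qed.

Lemma shifted_closed k : closed (shifted k).
Proof.
have := @closed_affine_preimage _ _ 1%:M (- ι k) T tile_closed.
by congr closed; apply/seteqP; split=> x; rewrite /= mul1mx.
Qed.

Lemma shifted_locally_finite (x : 'cV[R]_n.+1) :
  finite_set [set k | exists2 y, shifted k y & `|x - y| < 1].
Proof.
have [M M0 TM] := tile_bounded.
apply: sub_finite_set (@finite_int_ball R n (M + (1 + `|x|))) => k [y /TM yk xy] /=.
rewrite -[ι k](subKr y) opprB addrC (le_trans (ler_normD _ _))// distrC lerD//.
rewrite -[y](subKr x) (le_trans (ler_normB _ _))// addrC lerD2r.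
exact: ltW.
Qed.

(** The union of the translates contains the lattice and is stable under B, so it
    contains the points B^m z with z integral, which are dense. *)
Lemma shifted_cover x : exists k, shifted k x.
Proof.
have clE : closed (\bigcup_k shifted k).
  apply: closed_locally_finite => [k|x']; first exact: shifted_closed.
  by exists 1 => //; exact: shifted_locally_finite.
suff [k _ kx] : (\bigcup_k shifted k) x by exists k.
have shrink m y : (\bigcup_k shifted k) y -> (\bigcup_k shifted k) (B ^+ m *m y).
  elim: m => [|m IH]; first by rewrite mul1mx.
  move=> /IH[k _ Tk]; exists (quo k) => //.
  by rewrite exprS -mulmxA; exact: tile_contract_quotient Tk.
rewrite ((closure_id _).1 clE) => P /nbhs_ballP[e /= e0 eP].
(* z is the integer part of A^m x, so B^m z is within e of x. *)
have /filter_ex[m small] := power_cvg0 ler01 e0.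
pose z : 'cV[int]_n.+1 := \col_i Num.floor ((AR ^+ m *m x) i 0).
exists (B ^+ m *m ι z); split.
  by apply: shrink; exists z => //; rewrite /shifted/= subrr; exact: tile0.
apply: eP; rewrite -ball_normE/=.
have -> : x = B ^+ m *m (AR ^+ m *m x).
  by rewrite mulmxA expBA mul1mx.
rewrite -mulmxBr; apply: small; apply: norm_le_coord => // i.
rewrite !mxE; set u := (X in `|X - _|).
have /andP[u1 u2] := floor_itv u.
rewrite ger0_norm ?subr_ge0// lerBlDl ltW//.
by rewrite -intrD1.
Qed.

Definition overlap : set 'cV[R]_n.+1 :=
  [set x | exists k1 k2, [/\ k1 <> k2, shifted k1 x & shifted k2 x]].

Lemma overlap_closed : closed overlap.
Proof.
have -> : overlap = \bigcup_(k : 'cV[int]_n.+1 * 'cV[int]_n.+1)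
    (if k.1 == k.2 then set0 else shifted k.1 `&` shifted k.2).
  apply/seteqP; split=> x.
    by move=> [k1 [k2 [/eqP/negbTE k12 T1 T2]]]; exists (k1, k2) => //=; rewrite k12.
  by case=> -[k1 k2] _ /=; case: eqP => // k12 [T1 T2]; exists k1, k2.
apply: closed_locally_finite => [[k1 k2]|x] /=.
  case: ifP => _; first exact: closed0.
  by apply: closedI; exact: shifted_closed.
exists 1 => //; have fin := shifted_locally_finite x.
apply: sub_finite_set (finite_setX fin fin) => -[k1 k2] [y] /=.
by case: eqP => // _ [T1 T2] xy; split; exists y.
Qed.

Lemma overlap_periodic x k : overlap (x + ι k) -> overlap x.
Proof.
move=> [k1 [k2 [k12 T1 T2]]]; exists (k1 - k), (k2 - k); split.
- by move/addIr.
- by rewrite /shifted/= map_mxB opprB addrA.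
- by rewrite /shifted/= map_mxB opprB addrA.
Qed.

(** Expanding a point of T + k gives a point of T + (d + A k); by uniqueness of
    digits distinct k lead to distinct d + A k. *)
Lemma overlap_expand x : overlap (B *m x) -> overlap x.
Proof.
have step k : shifted k (B *m x) -> exists2 d, D d & shifted (d + A *m k) x.
  move=> /tile_expand[d Dd]; rewrite mulmxBr mulAB => Td; exists d => //.
  by rewrite /shifted/= intr_expansion opprD addrA addrAC.
move=> [k1 [k2 [k12 /step[d1 Dd1 T1] /step[d2 Dd2 T2]]]].
exists (d1 + A *m k1), (d2 + A *m k2); split=> //.
by move/(digit_unique detA hD Dd1 Dd2) => -[].
Qed.

Lemma overlap_null k1 k2 : ~ overlap 0 -> k1 <> k2 ->
  lebesgue_outer (translate T k1 `&` translate T k2) = 0%E.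
Proof.
move=> ov0 k12; have [M M0 TM] := tile_bounded; rewrite !translateE.
apply: (@null_of_invariant _ _ B overlap _ _ _ ov0 _ _ _
  (ι k1 - const_mx M) (ι k1 + const_mx M)).
- by rewrite unitmx_inv.
- move=> t e e0; apply: filterS (power_cvg0 (normr_ge0 t) e0) => m; exact.
- exact: overlap_closed.
- exact: overlap_periodic.
- exact: overlap_expand.
- by move=> x [T1 T2]; exists k1, k2.
- move=> x [/TM xM _] i; rewrite !mxE -ler_distl.
  by have := coord_le_norm (x - ι k1) i; rewrite !mxE => /le_trans; apply.
Qed.

(** * From radix representations to tilings *)

(** A lattice point w with -w in T is the quotient of some w' = d + A w with -w'
    again in T.  Going back N steps stays among the finitely many lattice points
    of a ball; for N large enough all of them are sent to 0 in N steps. *)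
Lemma radix_isolates_origin k :
  (forall x, exists N, iter N quo x = 0) -> shifted k 0 -> k = 0.
Proof.
move=> nil; have [M M0 TM] := tile_bounded.
have [s sE] := (finite_seqP _).1 (@finite_int_ball R n M).
have [N sN] : exists N, forall w, w \in s -> iter N quo w = 0.
  elim: s {sE} => [|w s [N sN]]; first by exists 0%N.
  have [N' wN'] := nil w; exists (N + N')%N => v.
  rewrite inE => /predU1P[->|/sN vN].
    by rewrite iterD wN'; elim: N {sN} => //= N ->; exact: quotient0.
  by rewrite addnC iterD vN; elim: N' {wN'} => //= N' ->; exact: quotient0.
have back m w : shifted w 0 -> exists2 w', shifted w' 0 & iter m quo w' = w.
  elim: m w => [|m IH] w Tw; first by exists w.
  have [d Dd] := tile_expand Tw; rewrite sub0r mulmxN -opprD addrC -intr_expansion => Td.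
  have [|w' Tw' w'E] := IH (d + A *m w); first by rewrite /shifted/= sub0r.
  by exists w' => //; rewrite iterS w'E quotientE.
move=> /(back N)[w /TM]; rewrite sub0r normrN => wM <-; apply: sN.
by have : [set z : 'cV[int]_n.+1 | `|ι z| <= M] w by []; rewrite sE.
Qed.

Lemma radix_tiles : (forall x, exists N, iter N quo x = 0) ->
  tiles_by_integer_translation T /\ interior T 0.
Proof.
move=> nil.
have iso k : shifted k 0 -> k = 0 by exact: radix_isolates_origin.
split.
  split; first exact: caratheodory_closed tile_closed.
    rewrite -subTset => x _; have [k kx] := shifted_cover x.
    by exists k => //; rewrite translateE.
  move=> k1 k2; apply: overlap_null => -[j1 [j2 [j12 /iso j1E /iso j2E]]].
  by apply: j12; rewrite j1E.
have clO : closed (\bigcup_k (if k == 0 then set0 else shifted k)).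
  apply: closed_locally_finite => [k|x].
    by case: ifP => _; [exact: closed0|exact: shifted_closed].
  exists 1 => //; apply: sub_finite_set (shifted_locally_finite x) => k [y].
  by case: eqP => // _ Ty xy; exists y.
apply: (@interiorS _ (~` (\bigcup_k (if k == 0 then set0 else shifted k)))).
  move=> x nOx; have [k kx] := shifted_cover x.
  have [k0|/negbTE k0] := eqVneq k 0.
    by move: kx; rewrite k0 /shifted/= map_mx0 subr0.
  by case: nOx; exists k => //; rewrite k0.
apply/open_nbhs_nbhs; split; first by rewrite openC.
by case=> k _; case: eqP => // k0 /iso.
Qed.

(** * From tilings to radix representations *)

(** T contains a copy of B^m T through each of its points x: take y to be the
    m-th remainder in an expansion of x. *)
Lemma tile_zoom m x : T x ->
  exists2 y, T y & forall z, T z -> T (x + B ^+ m *m (z - y)).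
Proof.
move=> Tx; elim: m => [|m [y Ty yz]].
  by exists x => // z Tz; rewrite mul1mx addrC subrK.
have [d Dd Td] := tile_expand Ty; exists (AR *m y - ι d) => // z Tz.
have := yz _ (tile_contract Tz Dd).
by rewrite exprSr -mulmxA opprB addrA [B *m (_ - _)]mulmxBr mulBA.
Qed.

(** By induction on m, phi^m x differs from B^m x by a point of the tile. *)
Lemma orbit_bounded x : exists M : R, forall m, `|ι (iter m quo x)| <= M.
Proof.
have [K K0 BK] := power_bound; have [M M0 TM] := tile_bounded.
exists (K * `|ι x| + M) => m.
suff /TM : T (B ^+ m *m ι x - ι (iter m quo x)).
  move=> tM; rewrite -[ι (iter m quo x)](subKr (B ^+ m *m ι x)).
  by rewrite (le_trans (ler_normB _ _))// lerD.
elim: m => [|m IH]; first by rewrite mul1mx subrr; exact: tile0.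
by rewrite exprS -mulmxA; exact: tile_contract_quotient IH.
Qed.

(** A periodic point w of the orbit satisfies -w in T, so for w <> 0 the distinct
    tiles T and T + w both contain a box near 0. *)
Lemma tiling_nilpotent x :
    (forall k, k <> 0 -> lebesgue_outer (translate T 0 `&` translate T k) = 0%E) ->
    interior T 0 ->
  exists N, iter N quo x = 0.
Proof.
move=> null int0; have [M orbM] := orbit_bounded x.
have [i [j [ij orbE]]] : exists i j, (i < j)%N /\ iter i quo x = iter j quo x.
  apply: contrapT => noij; apply: infinite_nat.
  pose orb m := iter m quo x.
  have orb_inj : {in [set: nat] &, injective orb}.
    move=> i j _ _ ijE; apply: contrapT => /eqP; rewrite neq_ltn.
    by case/orP => ij; apply: noij; [exists i, j|exists j, i].
  rewrite -(eq_finite_set (inj_card_eq orb_inj)).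
  apply: sub_finite_set (@finite_int_ball R n M) => _ [m _ <-].
  exact: orbM.
exists i; set w := iter i quo x; apply: contrapT => w0.
have per : iter (j - i) quo w = w by rewrite /w -iterD subnK// ltnW.
(* The negatives of the points of the cycle of w form a set to which the
   maximality of T applies. *)
have Tw : T (- ι w).
  have [M' wM] := orbit_bounded w.
  have := @tile_maximal [set y | exists m, y = - ι (iter m quo w)] M'.
  apply; last by exists 0%N.
    by move=> _ [m ->]; rewrite normrN.
  move=> _ [m ->]; set w' := iter (m + (j - i).-1) quo w.
  have w'E : quo w' = iter m quo w.
    by rewrite /w' -iterS -addnS prednK ?subn_gt0// iterD per.
  exists (dig w'); first exact: digitP.
  exists (m + (j - i).-1)%N; rewrite -/w' {2}(digit_quotientE hD w').
  by rewrite intr_expansion w'E mulmxN opprD addrC.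
have /nbhs_ballP[r /= r0 rT] := int0.
have ballT (y : 'cV[R]_n.+1) : `|y| < r -> T y.
  by move=> yr; apply: rT; rewrite -ball_normE/= sub0r normrN.
have [K K0 TK] := tile_bounded.
have [|m small] := filter_ex (@power_cvg0 (r + K) r _ r0).
  by rewrite addr_ge0// ltW.
have [y Ty yT] := tile_zoom m Tw.
have [c c0 Ac] := mulmx_norm_bound (AR ^+ m).
(* For z within h of z0, the point A^m (z - z0) is in the ball of radius r, so T
   contains the corresponding point - w + z of its copy through - w. *)
pose h := r / (2 * c); have h0 : 0 < h by rewrite divr_gt0// mulr_gt0.
pose z0 := - (B ^+ m *m y).
have boxT : box (z0 - const_mx h) (z0 + const_mx h) `<=`
    translate T 0 `&` translate T w.
  move=> z zbox; have zz0 : `|z - z0| <= h.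
    apply: norm_le_coord; first exact: ltW.
    by move=> l; have := zbox l; rewrite !mxE -ler_distl.
  pose u := AR ^+ m *m (z - z0).
  have ur : `|u| < r.
    apply: le_lt_trans (Ac _) _.
    apply: le_lt_trans (ler_wpM2l (ltW c0) zz0) _.
    have -> : c * h = r / 2 by rewrite /h; field; rewrite gt_eqF.
    by rewrite ltr_pdivrMr// mulr_natr mulr2n ltrDl.
  have zE : z = B ^+ m *m (u - y).
    rewrite mulmxBr /u mulmxA expBA.
    by rewrite mul1mx /z0 opprK addrK.
  rewrite !translateE; split; rewrite /shifted/= ?map_mx0 ?subr0.
    apply: ballT; rewrite zE; apply: small.
    by rewrite (le_trans (ler_normB _ _))// lerD ?TK// ltW.
  by have := yT u (ballT u ur); rewrite -zE addrC.
have := le_lebesgue_outer boxT; rewrite null// lebesgue_outer_box; last first.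
  by move=> l; rewrite !mxE; lra.
rewrite lee_fin leNgt => /negP; apply.
by apply: prodr_gt0 => l _; rewrite !mxE; lra.
Qed.

End Tile.

Theorem theorem6 (R : realType) (n : nat) (hn : (0 < n)%N)
    (A : 'M[int]_n) (D : set 'cV[int]_n)
    (hA : dilation_matrix R A) (hD : digit_set A D) :
  yields_radix_representation A D <->
  (tiles_by_integer_translation (digit_tile R A D) /\
   interior (digit_tile R A D) (0%R : 'cV[R]_n)).
Proof.
case: n hn A D hA hD => [//|n] _ A D hA hD.
rewrite (radix_iff_nilpotent (dilation_det hA) hD); split=> [|[[_ _ null] int0] x].
  exact: radix_tiles.
by apply: tiling_nilpotent int0 => // k k0; apply: null => /esym.
Qed.
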